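(* Let $\rho > 1$ and let $f$ be analytic inside and on the Bernstein ellipse $\mathcal{E}_\rho$. Let $b_n$ denote the Chebyshev coefficients of the second kind of $f$. Then for each integer $n \geq 0$, $$b_n = \frac{1}{2\pi \rho^n} \int_{0}^{2\pi} f\left( \tfrac{1}{2}\left(\rho e^{i\theta} + (\rho e^{i\theta})^{-1}\right) \right)\left(1 - (\rho e^{i\theta})^{-2}\right) e^{-in\theta}\, d\theta.$$
   Context: For $\rho \ge 1$ the Bernstein ellipse is $\mathcal{E}_\rho = \{ z \in \mathbb{C} : z = \frac12(\rho e^{i\theta} + \rho^{-1}e^{-i\theta}),\ 0 \le \theta \le 2\pi\}$ (an ellipse with foci $\pm 1$; its interior contains $[-1,1]$ when $\rho>1$). $U_n$ is the Chebyshev polynomial of the second kind of degree $n$, $U_n(\cos\theta) = \sin((n+1)\theta)/\sin\theta$. The Chebyshev coefficients of the second kind of $f$ are $$b_n = \frac{2}{\pi}\int_{-1}^1 \sqrt{1-x^2}\, f(x)\,U_n(x)\,dx, \qquad n \ge 0,$$ so that $f(x) = \sum_{n=0}^\infty b_n U_n(x)$ on $[-1,1]$. *)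

(* Defs.v *)
From Stdlib Require Import Reals Lra.
From Coquelicot Require Import Coquelicot.
Open Scope R_scope.

Definition Cexp (z : C) : C := (exp (Re z) * cos (Im z), exp (Re z) * sin (Im z)).

(* Complex-valued integral of a function of a real variable, for the
   structure of [C] as a complete normed space over [R]. *)
Definition CInt (g : R -> C) (a b : R) : C :=
  RInt (V := C_R_CompleteNormedModule) g a b.

Definition bernstein_ellipse (rho : R) (z : C) : Prop :=
  exists theta : R, 0 <= theta <= 2 * PI /\
    z = (/ 2 * (rho * Cexp (Ci * theta) + / rho * Cexp (- (Ci * theta))))%C.

(* [z] lies in a bounded (path) component of the complement of [K].
   Paths are parametrised by [0, 1]; asking for continuity on all of [R] is no
   restriction, since a path on [0, 1] extends by constants. *)
Definition inside (K : C -> Prop) (z : C) : Prop :=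
  ~ K z /\
  exists M : R, forall gamma : R -> C,
    (forall t : R, continuous (U := C_UniformSpace) gamma t) ->
    (forall t : R, 0 <= t <= 1 -> ~ K (gamma t)) ->
    gamma 0 = z ->
    Cmod (gamma 1) <= M.

(* Complex differentiability throughout a neighbourhood of [z]. *)
Definition analytic_at (f : C -> C) (z : C) : Prop :=
  locally (T := C_UniformSpace) z
    (fun w => ex_derive (K := C_AbsRing) (V := C_NormedModule) f w).

Definition analytic_inside_and_on (f : C -> C) (K : C -> Prop) : Prop :=
  forall z : C, inside K z \/ K z -> analytic_at f z.

(* The polynomial of degree [n] characterised by [chebU_cos] below, given by
   its three-term recurrence. *)
Fixpoint chebU (n : nat) (x : R) : R :=
  match n with
  | O => 1
  | S m => match m with
           | O => 2 * x
           | S k => 2 * x * chebU m x - chebU k x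
           end
  end.

Lemma chebU_SS (n : nat) (x : R) :
  chebU (S (S n)) x = 2 * x * chebU (S n) x - chebU n x.
Proof. reflexivity. Qed.

Lemma chebU_sin (n : nat) (theta : R) :
  chebU n (cos theta) * sin theta = sin ((INR n + 1) * theta) /\
  chebU (S n) (cos theta) * sin theta = sin ((INR (S n) + 1) * theta).
Proof.
induction n as [|n [IH1 IH2]].
- split; simpl.
  + rewrite Rplus_0_l, !Rmult_1_l; reflexivity.
  + replace ((1 + 1) * theta) with (2 * theta) by ring.
    rewrite sin_2a; ring.
- split; [exact IH2|].
  rewrite chebU_SS, Rmult_minus_distr_r, Rmult_assoc, IH1, IH2.
  rewrite !S_INR in *.
  replace ((INR n + 1 + 1 + 1) * theta)
    with ((INR n + 1 + 1) * theta + theta) by ring.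
  replace ((INR n + 1) * theta)
    with ((INR n + 1 + 1) * theta - theta) by ring.
  rewrite sin_plus, sin_minus; ring.
Qed.

Lemma chebU_cos (n : nat) (theta : R) :
  sin theta <> 0 ->
  chebU n (cos theta) = sin ((INR n + 1) * theta) / sin theta.
Proof.
intros H; rewrite <- (proj1 (chebU_sin n theta)); field; exact H.
Qed.

Definition cheb_coef2 (f : C -> C) (n : nat) : C :=
  ((2 / PI)%R *
   CInt (fun x : R => sqrt (1 - x ^ 2)%R * f (RtoC x) * chebU n x) (-1) 1)%C.

(* Main.v *)
Require Import Defs.
From Stdlib Require Import Reals Lra Classical IndefiniteDescription.
From Coquelicot Require Import Coquelicot.
Open Scope R_scope.

(** With J(w) = (w + 1/w)/2, put g(w) = f(J(w)) (1 - w^-2) w^-n.  The map J sends the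
    annulus 1 <= |w| <= rho into the closed elliptic disc, so F(z) = g(e^z) is
    differentiable on the rectangle [0, ln rho] x [0, 2 pi].  By Goursat's theorem its
    boundary integral vanishes, and the horizontal sides cancel by periodicity; hence the
    integral of g(r e^{i theta}) over [0, 2 pi] is the same for r = rho and r = 1.  For
    r = 1, adding the values at theta and 2 pi - theta gives
    4 f(cos theta) sin^2(theta) U_n(cos theta), and x = cos theta finishes the proof.
    Only pointwise differentiability of f is assumed, so Goursat's bisection argument
    cannot be replaced by Green's formula. *)

(** * Complex derivatives and continuity in epsilon-delta form *)

Notation is_Cderive := (is_derive (K := C_AbsRing) (V := AbsRing_NormedModule C_AbsRing)).
Notation ex_Cderive := (ex_derive (K := C_AbsRing) (V := AbsRing_NormedModule C_AbsRing)).
Notation Ccontinuous := (continuous (T := C_UniformSpace) (U := C_UniformSpace)).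

Lemma is_Cderive_eps (f : C -> C) (z l : C) :
  is_Cderive f z l <->
  forall eps : posreal, exists delta : posreal, forall w : C,
    Cmod (w - z) < delta -> Cmod (f w - f z - (w - z) * l) <= eps * Cmod (w - z).
Proof.
split.
- intros [_ H] eps.
  destruct (H z (fun P h => h) eps) as [d Hd].
  exists d; intros w Hw. exact (Hd w Hw).
- intros H; split; [apply is_linear_scal_l|].
  intros x Hx eps.
  (* The differential is required at every limit [x] of the neighbourhood filter of [z]; uniqueness
     of limits leaves only [z]. *)
  rewrite <- (is_filter_lim_locally_unique (V := AbsRing_NormedModule C_AbsRing) z x Hx).
  destruct (H eps) as [d Hd]. exists d; intros w Hw. exact (Hd w Hw).
Qed.

(** The two module structures put different uniform structures on the target [C], but the
    differential estimate sees only the norm, which is [Cmod] in both. *)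
Lemma ex_Cderive_of_C_NormedModule (f : C -> C) (z : C) :
  ex_derive (K := C_AbsRing) (V := C_NormedModule) f z -> ex_Cderive f z.
Proof.
intros [l [_ H]]. exists l. apply is_Cderive_eps. intros eps.
destruct (H z (fun P h => h) eps) as [d Hd].
exists d; intros w Hw. exact (Hd w Hw).
Qed.

(** The balls of [C_UniformSpace] are squares. A disc of radius e lies in the square of radius e,
    and the square of radius e / sqrt 2 lies in the disc of radius e; this is where the factors
    [sqrt 2] come from. *)
Lemma Ccontinuous_eps (f : C -> C) (z : C) :
  Ccontinuous f z <->
  forall eps : posreal, exists delta : posreal, forall w : C,
    Cmod (w - z) < delta -> Cmod (f w - f z) < eps.
Proof.
split.
- intros H eps.
  assert (He : 0 < eps / sqrt 2) by (apply Rdiv_lt_0_compat; [apply cond_pos | apply sqrt_lt_R0; lra]).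
  destruct (H (ball (M := C_UniformSpace) (f z) (mkposreal _ He)) (locally_ball _ _)) as [d Hd].
  exists d; intros w Hw.
  specialize (Hd w (C_NormedModule_mixin_compat1 _ _ _ Hw)).
  apply C_NormedModule_mixin_compat2 in Hd. simpl in Hd.
  replace (sqrt 2 * (eps / sqrt 2)) with (pos eps) in Hd; [exact Hd|].
  field. apply Rgt_not_eq, sqrt_lt_R0; lra.
- intros H P [e He].
  destruct (H e) as [d Hd].
  assert (He' : 0 < d / sqrt 2) by (apply Rdiv_lt_0_compat; [apply cond_pos | apply sqrt_lt_R0; lra]).
  exists (mkposreal _ He'). intros w Hw.
  apply He, C_NormedModule_mixin_compat1, Hd.
  apply C_NormedModule_mixin_compat2 in Hw. simpl in Hw.
  replace (sqrt 2 * (d / sqrt 2)) with (pos d) in Hw; [exact Hw|].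
  field. apply Rgt_not_eq, sqrt_lt_R0; lra.
Qed.

Lemma is_Cderive_continuous (f : C -> C) (z l : C) : is_Cderive f z l -> Ccontinuous f z.
Proof.
intros H. apply Ccontinuous_eps. intros eps.
(* Taking the error constant 1 gives the local Lipschitz bound |f w - f z| <= (1 + |l|) |w - z|. *)
destruct (proj1 (is_Cderive_eps f z l) H (mkposreal 1 Rlt_0_1)) as [d Hd].
pose proof (Cmod_ge_0 l) as Hl.
assert (He : 0 < Rmin d (eps / (1 + Cmod l))).
{ apply Rmin_pos; [apply cond_pos|]. apply Rdiv_lt_0_compat; [apply cond_pos|lra]. }
exists (mkposreal _ He). intros w Hw; simpl in Hw.
assert (H1 := Rlt_le_trans _ _ _ Hw (Rmin_l _ _)).
assert (H2 := Rlt_le_trans _ _ _ Hw (Rmin_r _ _)).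
specialize (Hd w H1); simpl in Hd.
replace (f w - f z)%C with ((f w - f z - (w - z) * l) + (w - z) * l)%C by ring.
eapply Rle_lt_trans; [apply Cmod_triangle|]. rewrite Cmod_mult.
apply (Rmult_lt_compat_r (1 + Cmod l)) in H2; [|lra].
unfold Rdiv in H2; rewrite Rmult_assoc, Rinv_l, Rmult_1_r in H2 by lra. lra.
Qed.

(** * Goursat's theorem for rectangles *)

Lemma nested_intervals (u v : nat -> R) :
  (forall k, u k <= u (S k)) -> (forall k, v (S k) <= v k) -> (forall k, u k <= v k) ->
  exists x, forall k, u k <= x <= v k.
Proof.
intros Hu Hv Huv.
assert (Hmon : forall k j, u k <= u (k + j)%nat /\ v (k + j)%nat <= v k).
{ intros k j; induction j as [|j IH]; [rewrite Nat.add_0_r; lra|].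
  rewrite Nat.add_succ_r. specialize (Hu (k + j)%nat). specialize (Hv (k + j)%nat). lra. }
assert (Hcross : forall j k, u j <= v k).
{ intros j k. pose proof (Hmon j k) as [H1 _]. pose proof (Hmon k j) as [_ H2].
  rewrite (Nat.add_comm k j) in H2. specialize (Huv (j + k)%nat). lra. }
destruct (completeness (fun x => exists k, x = u k)) as [x [Hx1 Hx2]].
- exists (v O). intros x [k ->]. apply Hcross.
- exists (u O), O. reflexivity.
- exists x. intros k. split.
  + apply Hx1. exists k; reflexivity.
  + apply Hx2. intros y [j ->]. apply Hcross.
Qed.

(** Compactness by bisection, for a property of the rectangle [a, b] x [c, d]. If [P] failed on the
    whole rectangle, it would fail on one of the four quarters, and so on; the failing rectangles
    shrink to a point, near which the local hypothesis makes [P] true. *)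
Lemma rectangle_bisection (P : R -> R -> R -> R -> Prop) (a0 b0 c0 d0 : R) :
  a0 <= b0 -> c0 <= d0 ->
  (forall a b c d, a0 <= a -> a <= b -> b <= b0 -> c0 <= c -> c <= d -> d <= d0 ->
     P a ((a + b) / 2) c ((c + d) / 2) -> P ((a + b) / 2) b c ((c + d) / 2) ->
     P a ((a + b) / 2) ((c + d) / 2) d -> P ((a + b) / 2) b ((c + d) / 2) d ->
     P a b c d) ->
  (forall x y, a0 <= x <= b0 -> c0 <= y <= d0 -> exists delta, 0 < delta /\
     forall a b c d, a0 <= a -> a <= x <= b -> b <= b0 -> c0 <= c -> c <= y <= d -> d <= d0 ->
     (b - a) + (d - c) < delta -> P a b c d) ->
  P a0 b0 c0 d0.
Proof.
intros Hab Hcd Hsplit Hloc. apply NNPP. intros HN.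
set (quad := (R * R * (R * R))%type).
set (bad := fun q : quad => let '((a, b), (c, d)) := q in
  (a0 <= a /\ a <= b /\ b <= b0 /\ c0 <= c /\ c <= d /\ d <= d0) /\ ~ P a b c d).
assert (Hstep : forall q : {q | bad q}, exists q' : {q | bad q},
  let '((a, b), (c, d)) := proj1_sig q in let '((a', b'), (c', d')) := proj1_sig q' in
  a <= a' /\ b' <= b /\ c <= c' /\ d' <= d /\ b' - a' = (b - a) / 2 /\ d' - c' = (d - c) / 2).
{ intros [[[a b] [c d]] [Hr HP]]; simpl.
  destruct (classic (P a ((a + b) / 2) c ((c + d) / 2))) as [H1|H1];
  [destruct (classic (P ((a + b) / 2) b c ((c + d) / 2))) as [H2|H2];
  [destruct (classic (P a ((a + b) / 2) ((c + d) / 2) d)) as [H3|H3];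
  [destruct (classic (P ((a + b) / 2) b ((c + d) / 2) d)) as [H4|H4]|]|]|].
  - exfalso. apply HP, Hsplit; tauto.
  - unshelve eexists; [exists (((a + b) / 2, b), ((c + d) / 2, d)); split; [lra|exact H4]|simpl; lra].
  - unshelve eexists; [exists ((a, (a + b) / 2), ((c + d) / 2, d)); split; [lra|exact H3]|simpl; lra].
  - unshelve eexists; [exists (((a + b) / 2, b), (c, (c + d) / 2)); split; [lra|exact H2]|simpl; lra].
  - unshelve eexists; [exists ((a, (a + b) / 2), (c, (c + d) / 2)); split; [lra|exact H1]|simpl; lra]. }
(* Failing rectangles are packed with their proofs of failure, so that choice yields a total map
   that can be iterated. *)
apply functional_choice in Hstep. destruct Hstep as [next Hnext].
assert (Hbad0 : bad ((a0, b0), (c0, d0))) by (split; [lra|exact HN]).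
set (q := fix q (k : nat) : {q | bad q} :=
  match k with O => exist _ _ Hbad0 | S k => next (q k) end).
set (A := fun k => fst (fst (proj1_sig (q k)))). set (B := fun k => snd (fst (proj1_sig (q k)))).
set (E := fun k => fst (snd (proj1_sig (q k)))). set (D := fun k => snd (snd (proj1_sig (q k)))).
assert (Hq : forall k, (a0 <= A k /\ A k <= B k /\ B k <= b0 /\ c0 <= E k /\ E k <= D k /\ D k <= d0)
  /\ ~ P (A k) (B k) (E k) (D k)).
{ intros k. unfold A, B, E, D. destruct (q k) as [[[a b] [c d]] H]. exact H. }
assert (Hs : forall k, A k <= A (S k) /\ B (S k) <= B k /\ E k <= E (S k) /\ D (S k) <= D k /\
  B (S k) - A (S k) = (B k - A k) / 2 /\ D (S k) - E (S k) = (D k - E k) / 2).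
{ intros k. specialize (Hnext (q k)). unfold A, B, E, D. simpl (q (S k)).
  destruct (proj1_sig (q k)) as [[a b] [c d]].
  destruct (proj1_sig (next (q k))) as [[a' b'] [c' d']]. exact Hnext. }
destruct (nested_intervals A B) as [x Hx];
  [intros k; apply Hs | intros k; apply Hs | intros k; apply Hq|].
destruct (nested_intervals E D) as [y Hy];
  [intros k; apply Hs | intros k; apply Hs | intros k; apply Hq|].
assert (Hsize : forall k, (B k - A k) + (D k - E k) = ((b0 - a0) + (d0 - c0)) * (/ 2) ^ k).
{ induction k as [|k IH]; [unfold A, B, E, D; simpl; ring|].
  destruct (Hs k) as (_ & _ & _ & _ & -> & ->). simpl. lra. }
destruct (Hloc x y) as [delta [Hd HP]].
{ specialize (Hx O). exact Hx. }
{ specialize (Hy O). exact Hy. }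
set (L := (b0 - a0) + (d0 - c0)) in *.
(* Dividing by [L + 1] rather than [L] also covers a rectangle reduced to a point, where [L] is
   0. *)
destruct (pow_lt_1_zero (/ 2)) with (y := delta / (L + 1)) as [N HN'].
{ rewrite Rabs_pos_eq; lra. }
{ apply Rdiv_lt_0_compat; unfold L; lra. }
specialize (HN' N (le_n N)).
rewrite Rabs_pos_eq in HN' by (apply pow_le; lra).
destruct (Hq N) as [Hr HNP]. apply HNP, HP; try apply Hx; try apply Hy; try lra.
rewrite Hsize.
apply (Rmult_lt_compat_r (L + 1)) in HN'; [|unfold L; lra].
unfold Rdiv in HN'; rewrite Rmult_assoc, Rinv_l, Rmult_1_r in HN' by (unfold L; lra).
assert (0 < (/ 2) ^ N) by (apply pow_lt; lra). lra.
Qed.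

(** * Integrals of complex-valued functions over real intervals *)

Lemma scal_RtoC (r : R) (z : C) : scal (V := C_R_NormedModule) r z = (r * z)%C.
Proof. destruct z as [x y]; apply injective_projections; simpl; unfold scal; simpl; unfold mult; simpl; ring. Qed.

Lemma norm_C_R (z : C) : norm (V := C_R_NormedModule) z = Cmod z.
Proof.
unfold norm; simpl; unfold prod_norm, Cmod; simpl; unfold norm; simpl; unfold abs; simpl.
f_equal. rewrite !Rmult_1_r, <- !Rabs_mult, !Rabs_pos_eq by apply Rle_0_sqr. reflexivity.
Qed.

Notation ex_CInt := (ex_RInt (V := C_R_NormedModule)).
Notation RCcontinuous := (continuous (T := R_UniformSpace) (U := C_UniformSpace)).

Lemma CInt_ext (f g : R -> C) (a b : R) :
  (forall x, Rmin a b < x < Rmax a b -> f x = g x) -> CInt f a b = CInt g a b.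
Proof. apply (RInt_ext (V := C_R_CompleteNormedModule)). Qed.

Lemma ex_CInt_continuous (f : R -> C) (a b : R) :
  (forall x, Rmin a b <= x <= Rmax a b -> RCcontinuous f x) -> ex_CInt f a b.
Proof. apply (ex_RInt_continuous (V := C_R_CompleteNormedModule)). Qed.

Lemma CInt_plus (f g : R -> C) (a b : R) :
  ex_CInt f a b -> ex_CInt g a b ->
  CInt (fun x => f x + g x)%C a b = (CInt f a b + CInt g a b)%C.
Proof. apply (RInt_plus (V := C_R_CompleteNormedModule)). Qed.

Lemma CInt_scal (r : R) (f : R -> C) (a b : R) :
  ex_CInt f a b -> CInt (fun x => r * f x)%C a b = (r * CInt f a b)%C.
Proof.
intros H. etransitivity; [|etransitivity;
  [exact (RInt_scal (V := C_R_CompleteNormedModule) f a b r H) | apply scal_RtoC]].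
apply CInt_ext. intros x _. symmetry; apply scal_RtoC.
Qed.

Lemma CInt_Chasles (f : R -> C) (a b c : R) :
  ex_CInt f a b -> ex_CInt f b c -> (CInt f a b + CInt f b c)%C = CInt f a c.
Proof. apply (RInt_Chasles (V := C_R_CompleteNormedModule)). Qed.

Lemma Cmod_CInt_le (f : R -> C) (a b M : R) :
  a <= b -> ex_CInt f a b -> (forall x, a <= x <= b -> Cmod (f x) <= M) ->
  Cmod (CInt f a b) <= (b - a) * M.
Proof.
intros Hab Hex HM. rewrite <- norm_C_R.
apply (norm_RInt_le_const (V := C_R_NormedModule) f); [exact Hab| |].
- intros x Hx. rewrite norm_C_R. apply HM, Hx.
- apply (RInt_correct (V := C_R_CompleteNormedModule)), Hex.
Qed.

Lemma CInt_affine (A B : C) (a b : R) :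
  CInt (fun x => A + x * B)%C a b = ((b - a)%R * A + ((b ^ 2 - a ^ 2) / 2)%R * B)%C.
Proof.
set (G := fun x : R => plus (scal (V := C_R_NormedModule) x A) (scal (V := C_R_NormedModule) (x ^ 2 / 2) B)).
transitivity (minus (G := C_R_NormedModule) (G b) (G a)).
2: { unfold G. rewrite !scal_RtoC.
  change ((b * A + (b ^ 2 / 2)%R * B) + - (a * A + (a ^ 2 / 2)%R * B) =
    (b - a)%R * A + ((b ^ 2 - a ^ 2) / 2)%R * B)%C.
  destruct A, B; apply injective_projections; simpl; field. }
apply (is_RInt_unique (V := C_R_CompleteNormedModule)).
apply (is_RInt_ext (V := C_R_NormedModule)
  (fun x : R => plus (scal (V := C_R_NormedModule) 1 A) (scal (V := C_R_NormedModule) x B))).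
{ intros x _. rewrite !scal_RtoC.
  change (1 * A + x * B = A + x * B)%C. ring. }
apply (is_RInt_derive (V := C_R_CompleteNormedModule) G).
- intros x _. apply (is_derive_plus (V := C_R_NormedModule)).
  + apply (is_derive_scal_l (V := C_R_NormedModule)). apply (is_derive_id (K := R_AbsRing)).
  + apply (is_derive_scal_l (V := C_R_NormedModule)). auto_derive; [exact I|field].
- intros x _. apply (continuous_plus (V := C_R_NormedModule)).
  + apply continuous_const.
  + apply (continuous_scal_l (V := C_R_NormedModule)). apply continuous_id.
Qed.

(** * Contour integrals along the boundary of a rectangle *)

Definition Ccontinuous_on (F : C -> C) (a b c d : R) : Prop :=
  forall x y : R, a <= x <= b -> c <= y <= d -> Ccontinuous F (x, y).

Lemma RCcontinuous_pair (f g : R -> R) (x : R) :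
  continuous f x -> continuous g x -> RCcontinuous (fun t => (f t, g t)) x.
Proof.
intros Hf Hg P [eps HP].
pose proof (Hf _ (locally_ball (f x) eps)) as H1. pose proof (Hg _ (locally_ball (g x) eps)) as H2.
unfold filtermap in *. generalize (filter_and _ _ H1 H2).
apply filter_imp. intros t [H3 H4]. apply HP. split; assumption.
Qed.

Lemma continuous_Cmult_l (k : C) {U : UniformSpace} (f : U -> C) (x : U) :
  continuous (U := C_UniformSpace) f x -> continuous (U := C_UniformSpace) (fun t => k * f t)%C x.
Proof. apply (continuous_scal_r (K := C_AbsRing) (V := C_NormedModule)). Qed.

Lemma ex_CInt_horizontal (F : C -> C) (a b y : R) :
  a <= b -> (forall x, a <= x <= b -> Ccontinuous F (x, y)) -> ex_CInt (fun x => F (x, y)) a b.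
Proof.
intros Hab HF. apply ex_CInt_continuous. rewrite Rmin_left, Rmax_right by exact Hab.
intros x Hx. apply (continuous_comp (V := C_UniformSpace) (fun x : R => (x, y)) F).
- apply RCcontinuous_pair; [apply continuous_id | apply continuous_const].
- apply HF, Hx.
Qed.

Lemma ex_CInt_vertical (F : C -> C) (c d x : R) :
  c <= d -> (forall y, c <= y <= d -> Ccontinuous F (x, y)) -> ex_CInt (fun y => Ci * F (x, y))%C c d.
Proof.
intros Hcd HF. apply ex_CInt_continuous. rewrite Rmin_left, Rmax_right by exact Hcd.
intros y Hy. apply continuous_Cmult_l.
apply (continuous_comp (V := C_UniformSpace) (fun y : R => (x, y)) F).
- apply RCcontinuous_pair; [apply continuous_const | apply continuous_id].
- apply HF, Hy.
Qed.

(** The contour integral of F dz, taken counterclockwise; the factor [Ci] on the vertical sides is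
    dz = i dy. *)
Definition rect_int (F : C -> C) (a b c d : R) : C :=
  (CInt (fun x => F (x, c)) a b + CInt (fun y => Ci * F (b, y)) c d
   - CInt (fun x => F (x, d)) a b - CInt (fun y => Ci * F (a, y)) c d)%C.

Lemma rect_int_ext (F G : C -> C) (a b c d : R) :
  (forall z, F z = G z) -> rect_int F a b c d = rect_int G a b c d.
Proof.
intros H. unfold rect_int.
repeat match goal with |- (?x - ?y = ?u - ?v)%C => apply (f_equal2 Cminus) | |- (?x + ?y = ?u + ?v)%C => apply (f_equal2 Cplus) end;
apply CInt_ext; intros; rewrite H; reflexivity.
Qed.

Lemma rect_int_plus (F G : C -> C) (a b c d : R) :
  a <= b -> c <= d -> Ccontinuous_on F a b c d -> Ccontinuous_on G a b c d ->
  rect_int (fun z => F z + G z)%C a b c d = (rect_int F a b c d + rect_int G a b c d)%C.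
Proof.
intros Hab Hcd HF HG. unfold rect_int.
rewrite !(CInt_plus (fun x => F (x, _)) (fun x => G (x, _)))
  by (apply ex_CInt_horizontal; [exact Hab | intros; first [apply HF | apply HG]; lra]).
rewrite (CInt_ext (fun y => Ci * (F (b, y) + G (b, y)))%C (fun y => Ci * F (b, y) + Ci * G (b, y))%C)
  by (intros; ring).
rewrite (CInt_ext (fun y => Ci * (F (a, y) + G (a, y)))%C (fun y => Ci * F (a, y) + Ci * G (a, y))%C)
  by (intros; ring).
rewrite !(CInt_plus (fun y => Ci * F (_, y))%C (fun y => Ci * G (_, y))%C)
  by (apply ex_CInt_vertical; [exact Hcd | intros; first [apply HF | apply HG]; lra]).
ring.
Qed.

(** Cauchy's theorem for polynomials of degree at most 1, by explicit integration of the four sides.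
    It allows the tangent map to be subtracted from the integrand in Goursat's argument. *)
Lemma rect_int_affine (A l : C) (a b c d : R) : rect_int (fun z => A + z * l)%C a b c d = 0%C.
Proof.
assert (HC : (Ci * Ci = - (1))%C) by (apply injective_projections; simpl; ring).
assert (Hh : forall y, CInt (fun x => A + (x, y) * l)%C a b =
  ((b - a)%R * (A + Ci * y * l) + ((b ^ 2 - a ^ 2) / 2)%R * l)%C).
{ intros y. rewrite <- CInt_affine. apply CInt_ext. intros x _.
  replace ((x, y) : C) with (x + Ci * y)%C by (apply injective_projections; simpl; ring). ring. }
assert (Hv : forall x, CInt (fun y => Ci * (A + (x, y) * l))%C c d =
  ((d - c)%R * (Ci * (A + x * l)) + ((d ^ 2 - c ^ 2) / 2)%R * (- l))%C).
{ intros x. rewrite <- CInt_affine. apply CInt_ext. intros y _.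
  replace ((x, y) : C) with (x + Ci * y)%C by (apply injective_projections; simpl; ring).
  transitivity (Ci * (A + x * l) + Ci * Ci * y * l)%C; [ring | rewrite HC; ring]. }
unfold rect_int. rewrite !Hh, !Hv, !RtoC_minus. ring.
Qed.

(** The common side at abscissa [m] is traversed once in each direction, so its two contributions
    cancel. *)
Lemma rect_int_split_x (F : C -> C) (a b c d m : R) :
  a <= m <= b -> c <= d -> Ccontinuous_on F a b c d ->
  rect_int F a b c d = (rect_int F a m c d + rect_int F m b c d)%C.
Proof.
intros Hm Hcd HF. unfold rect_int.
rewrite <- !(CInt_Chasles (fun x => F (x, _)) a m b)
  by (apply ex_CInt_horizontal; [lra | intros; apply HF; lra]).
ring.
Qed.

Lemma rect_int_split_y (F : C -> C) (a b c d m : R) :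
  a <= b -> c <= m <= d -> Ccontinuous_on F a b c d ->
  rect_int F a b c d = (rect_int F a b c m + rect_int F a b m d)%C.
Proof.
intros Hab Hm HF. unfold rect_int.
rewrite <- !(CInt_Chasles (fun y => Ci * F (_, y))%C c m d)
  by (apply ex_CInt_vertical; [lra | intros; apply HF; lra]).
ring.
Qed.

(** The usual bound by length times maximum, the perimeter being twice the sum of the side
    lengths. *)
Lemma Cmod_rect_int_le (F : C -> C) (a b c d M : R) :
  a <= b -> c <= d -> Ccontinuous_on F a b c d ->
  (forall x y, a <= x <= b -> c <= y <= d -> Cmod (F (x, y)) <= M) ->
  Cmod (rect_int F a b c d) <= 2 * ((b - a) + (d - c)) * M.
Proof.
intros Hab Hcd HF HM.
assert (Hh : forall y, c <= y <= d -> Cmod (CInt (fun x => F (x, y)) a b) <= (b - a) * M).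
{ intros y Hy. apply Cmod_CInt_le; [exact Hab| |intros x Hx; apply HM; assumption].
  apply ex_CInt_horizontal; [exact Hab | intros; apply HF; lra]. }
assert (Hv : forall x, a <= x <= b -> Cmod (CInt (fun y => Ci * F (x, y))%C c d) <= (d - c) * M).
{ intros x Hx. apply Cmod_CInt_le; [exact Hcd| |].
  - apply ex_CInt_vertical; [exact Hcd | intros; apply HF; lra].
  - intros y Hy. rewrite Cmod_mult, Cmod_Ci, Rmult_1_l. apply HM; assumption. }
unfold rect_int, Cminus.
eapply Rle_trans; [apply Cmod_triangle|]. rewrite Cmod_opp.
eapply Rle_trans; [apply Rplus_le_compat_r, Cmod_triangle|]. rewrite Cmod_opp.
eapply Rle_trans; [apply Rplus_le_compat_r, Rplus_le_compat_r, Cmod_triangle|].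
pose proof (Hh c ltac:(lra)). pose proof (Hh d ltac:(lra)).
pose proof (Hv a ltac:(lra)). pose proof (Hv b ltac:(lra)). lra.
Qed.

Lemma Cmod_le_Rabs_plus (z : C) : Cmod z <= Rabs (fst z) + Rabs (snd z).
Proof.
destruct z as [x y]. replace ((x, y) : C) with (x + Ci * y)%C by (apply injective_projections; simpl; ring).
eapply Rle_trans; [apply Cmod_triangle|]. rewrite Cmod_mult, Cmod_Ci, !Cmod_R. simpl.
replace (x + (0 * y - 1 * 0)) with x by ring. replace (0 + (0 * 0 + 1 * y)) with y by ring. lra.
Qed.

Lemma affine_continuous (A l z : C) : Ccontinuous (fun z => A + z * l)%C z.
Proof.
apply is_Cderive_continuous with l, is_Cderive_eps. intros eps. exists (mkposreal 1 Rlt_0_1).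
intros w _. replace (_ - _)%C with (RtoC 0) by ring. rewrite Cmod_0.
apply Rmult_le_pos; [apply Rlt_le, cond_pos | apply Cmod_ge_0].
Qed.

Lemma Goursat_rectangle (F : C -> C) (a b c d : R) :
  a <= b -> c <= d ->
  (forall x y, a <= x <= b -> c <= y <= d -> ex_Cderive F (x, y)) ->
  rect_int F a b c d = 0%C.
Proof.
intros Hab Hcd HF.
assert (Hcont : forall x y, a <= x <= b -> c <= y <= d -> Ccontinuous F (x, y)).
{ intros x y Hx Hy. destruct (HF x y Hx Hy) as [l Hl]. exact (is_Cderive_continuous _ _ _ Hl). }
apply Cmod_eq_0, Rle_antisym; [|apply Cmod_ge_0].
(* With s the half-perimeter, the bound 2 eps s^2 is stable under quartering: each quarter has
   half-perimeter s / 2, and four times 2 eps (s / 2)^2 is again 2 eps s^2. *)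
assert (H : forall eps, 0 < eps ->
  Cmod (rect_int F a b c d) <= 2 * eps * ((b - a) + (d - c)) ^ 2).
{ intros eps Heps.
  apply (rectangle_bisection (fun a b c d => Cmod (rect_int F a b c d) <= 2 * eps * ((b - a) + (d - c)) ^ 2));
    [exact Hab | exact Hcd | |].
  - intros a' b' c' d' Ha Hab' Hb Hc Hcd' Hd H1 H2 H3 H4.
    rewrite (rect_int_split_x F a' b' c' d' ((a' + b') / 2)) by (try lra; intros x y Hx Hy; apply Hcont; lra).
    rewrite (rect_int_split_y F a' ((a' + b') / 2) c' d' ((c' + d') / 2)) by (try lra; intros x y Hx Hy; apply Hcont; lra).
    rewrite (rect_int_split_y F ((a' + b') / 2) b' c' d' ((c' + d') / 2)) by (try lra; intros x y Hx Hy; apply Hcont; lra).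
    eapply Rle_trans; [apply Cmod_triangle|].
    eapply Rle_trans; [apply Rplus_le_compat; apply Cmod_triangle|].
    set (m := (a' + b') / 2) in *. set (k := (c' + d') / 2) in *.
    replace (m - a') with ((b' - a') / 2) in * by (unfold m; field).
    replace (b' - m) with ((b' - a') / 2) in * by (unfold m; field).
    replace (k - c') with ((d' - c') / 2) in * by (unfold k; field).
    replace (d' - k) with ((d' - c') / 2) in * by (unfold k; field).
    nra.
  - intros x0 y0 Hx0 Hy0. destruct (HF x0 y0 Hx0 Hy0) as [l Hl].
    destruct (proj1 (is_Cderive_eps _ _ _) Hl (mkposreal eps Heps)) as [delta Hd].
    exists delta. split; [apply cond_pos|].
    intros a' b' c' d' Ha Hx Hb Hc Hy Hd' Hs.
    set (z0 := ((x0, y0) : C)) in *.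
    (* [F] is split into its tangent map at [z0], which integrates to 0, and a remainder of modulus
       at most eps |z - z0| <= eps s. Over a perimeter 2 s this contributes at most 2 eps s^2. *)
    rewrite (rect_int_ext F (fun z => (F z + (- (F z0 - z0 * l) + z * - l)) + ((F z0 - z0 * l) + z * l))%C) by (intros; ring).
    assert (Herr : Ccontinuous_on (fun z => F z + (- (F z0 - z0 * l) + z * - l))%C a' b' c' d').
    { intros x y Hx' Hy'. apply (continuous_plus (V := C_NormedModule)).
      - apply Hcont; lra.
      - apply affine_continuous. }
    rewrite rect_int_plus, rect_int_affine, Cplus_0_r; try lra;
      [|exact Herr | intros x y _ _; apply affine_continuous].
    replace (2 * eps * _) with (2 * ((b' - a') + (d' - c')) * (eps * ((b' - a') + (d' - c')))) by ring.
    apply Cmod_rect_int_le; try lra; [exact Herr|].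
    intros x y Hx' Hy'.
    assert (Hm : Cmod ((x, y) - z0) <= (b' - a') + (d' - c')).
    { eapply Rle_trans; [apply Cmod_le_Rabs_plus|]. unfold z0; simpl.
      apply Rplus_le_compat; apply Rabs_le; lra. }
    replace (F (x, y) + (- (F z0 - z0 * l) + (x, y) * - l))%C with (F (x, y) - F z0 - ((x, y) - z0) * l)%C by ring.
    eapply Rle_trans; [apply Hd; lra|]. simpl. apply Rmult_le_compat_l; lra. }
set (X := Cmod _) in *. set (S := (_ + _) ^ 2) in *.
assert (HS : 0 <= S) by apply pow2_ge_0.
destruct (Rle_lt_dec X 0) as [HX|HX]; [exact HX|exfalso].
(* This choice of eps turns the bound into X <= X / 2 - X / (2 (S + 1)), impossible for X > 0; the
   summand 1 keeps the denominator positive when [S] is 0. *)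
assert (He : 0 < X / (4 * (S + 1))) by (apply Rdiv_lt_0_compat; lra).
specialize (H _ He).
replace (2 * (X / (4 * (S + 1))) * S) with (X / 2 - X / (2 * (S + 1))) in H by (field; lra).
assert (0 < X / (2 * (S + 1))) by (apply Rdiv_lt_0_compat; lra). lra.
Qed.

(** * The interior of the Bernstein ellipse *)

(** Coordinates of the Joukowsky image of a circle: an ellipse with semi-axes (r + 1/r)/2 and |r -
    1/r|/2, degenerating to [-1, 1] at r = 1. *)
Lemma joukowsky_polar (r theta : R) : r <> 0 ->
  (/ 2 * (r * Cexp (Ci * theta) + / r * Cexp (- (Ci * theta))))%C =
  ((r + / r) / 2 * cos theta, (r - / r) / 2 * sin theta).
Proof.
intros Hr. rewrite <- !RtoC_inv by (lra || assumption).
replace (Ci * theta)%C with ((0, theta) : C) by (apply injective_projections; simpl; ring).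
unfold Cexp, Copp; simpl. rewrite Ropp_0, exp_0, cos_neg, sin_neg.
apply injective_projections; simpl; field; assumption.
Qed.

Lemma cos_sin_surjective (u v : R) : u ^ 2 + v ^ 2 = 1 ->
  exists theta, 0 <= theta <= 2 * PI /\ cos theta = u /\ sin theta = v.
Proof.
intros H.
assert (Hu : -1 <= u <= 1) by nra.
pose proof (acos_bound u) as Hb.
assert (Hs : sin (acos u) = Rabs v).
{ rewrite sin_acos by exact Hu. rewrite <- sqrt_Rsqr_abs. f_equal. unfold Rsqr. lra. }
destruct (Rle_lt_dec 0 v) as [Hv|Hv].
- exists (acos u). rewrite cos_acos, Hs, Rabs_pos_eq by assumption. lra.
- exists (2 * PI - acos u). split; [lra|].
  rewrite cos_minus, sin_minus, cos_2PI, sin_2PI, cos_acos, Hs, Rabs_left by assumption. lra.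
Qed.

Lemma Rinv_between_0_1 (r : R) : 1 < r -> 0 < / r < 1.
Proof.
intros Hr. split; [apply Rinv_0_lt_compat; lra|].
rewrite <- Rinv_1. apply Rinv_lt_contravar; lra.
Qed.

(** The Cartesian equation presents the ellipse as the zero set of a continuous function, to which
    the intermediate value theorem can be applied along a path. *)
Lemma bernstein_ellipse_equation (rho : R) (z : C) : 1 < rho ->
  (bernstein_ellipse rho z <->
   (fst z / ((rho + / rho) / 2)) ^ 2 + (snd z / ((rho - / rho) / 2)) ^ 2 = 1).
Proof.
intros Hr.
pose proof (Rinv_between_0_1 rho Hr) as Hi.
unfold bernstein_ellipse. set (A := (rho + / rho) / 2). set (B := (rho - / rho) / 2).
assert (HA : 0 < A) by (unfold A; lra). assert (HB : 0 < B) by (unfold B; lra).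
split.
- intros [theta [_ ->]]. rewrite joukowsky_polar by lra. fold A B; cbn [fst snd].
  replace (A * cos theta / A) with (cos theta) by (field; lra).
  replace (B * sin theta / B) with (sin theta) by (field; lra).
  pose proof (sin2_cos2 theta); unfold Rsqr in *; lra.
- intros H. destruct (cos_sin_surjective _ _ H) as [theta [Ht [Hc Hs]]].
  exists theta. split; [exact Ht|]. rewrite joukowsky_polar by lra. fold A B.
  rewrite Hc, Hs. destruct z as [x y]; apply injective_projections; cbn [fst snd]; field; lra.
Qed.

(** The defining quadratic function is negative at the start of the path and cannot vanish along it,
    so the path cannot end where it is positive. Its endpoint therefore stays in a bounded
    region. *)
Lemma inside_bernstein_ellipse (rho : R) (z : C) : 1 < rho ->
  (fst z / ((rho + / rho) / 2)) ^ 2 + (snd z / ((rho - / rho) / 2)) ^ 2 < 1 ->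
  inside (bernstein_ellipse rho) z.
Proof.
intros Hr Hz.
pose proof (Rinv_between_0_1 rho Hr) as Hi.
split.
{ rewrite bernstein_ellipse_equation by exact Hr. lra. }
(* The bound is the sum of the semi-axes, because [Cmod] is at most the sum of the absolute values
   of the coordinates. *)
exists ((rho + / rho) / 2 + (rho - / rho) / 2).
intros gamma Hcont Havoid H0.
assert (Hphi : forall t, 0 <= t <= 1 ->
  (fst (gamma t) / ((rho + / rho) / 2)) ^ 2 + (snd (gamma t) / ((rho - / rho) / 2)) ^ 2 - 1 <> 0).
{ intros t Ht He. apply (Havoid t Ht), bernstein_ellipse_equation; lra. }
set (A := (rho + / rho) / 2) in *. set (B := (rho - / rho) / 2) in *.
assert (HA : 0 < A) by (unfold A; lra). assert (HB : 0 < B) by (unfold B; lra).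
set (phi := fun t => (fst (gamma t) / A) ^ 2 + (snd (gamma t) / B) ^ 2 - 1).
assert (Hphic : continuity phi).
{ intros t. apply continuity_pt_filterlim.
  assert (Hc1 : continuous (fun t => fst (gamma t)) t)
    by (apply (continuous_comp (V := C_UniformSpace) gamma fst); [apply Hcont | apply continuous_fst]).
  assert (Hc2 : continuous (fun t => snd (gamma t)) t)
    by (apply (continuous_comp (V := C_UniformSpace) gamma snd); [apply Hcont | apply continuous_snd]).
  assert (Hsq : forall k x : R, continuous (fun x => (x / k) ^ 2) x)
    by (intros k x; apply (ex_derive_continuous (K := R_AbsRing) (V := R_NormedModule)); auto_derive; exact I).
  apply (continuous_minus (V := R_NormedModule)); [apply (continuous_plus (V := R_NormedModule)) | apply continuous_const].
  - apply (continuous_comp (fun t => fst (gamma t)) (fun x => (x / A) ^ 2)); [exact Hc1 | apply Hsq].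
  - apply (continuous_comp (fun t => snd (gamma t)) (fun x => (x / B) ^ 2)); [exact Hc2 | apply Hsq]. }
(* A positive value at 1 would force a zero of [phi] in [0, 1], that is, a crossing of the
   ellipse. *)
assert (H1 : phi 1 <= 0).
{ destruct (Rle_lt_dec (phi 1) 0) as [h|h]; [exact h|exfalso].
  destruct (IVT phi 0 1 Hphic Rlt_0_1) as [t [Ht Hz0]]; [unfold phi; rewrite H0; lra | exact h |].
  exact (Hphi t Ht Hz0). }
unfold phi in H1.
assert (Hle : forall p q : R, 0 < q -> (p / q) ^ 2 <= 1 -> Rabs p <= q).
{ intros p q Hq Hpq.
  assert (Hpq' : -1 <= p / q <= 1) by nra.
  replace p with (p / q * q) by (field; lra). apply Rabs_le; nra. }
eapply Rle_trans; [apply Cmod_le_Rabs_plus|].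
pose proof (pow2_ge_0 (fst (gamma 1) / A)). pose proof (pow2_ge_0 (snd (gamma 1) / B)).
apply Rplus_le_compat; apply Hle; lra.
Qed.

(** Both r + 1/r and r - 1/r increase for r >= 1. So r = rho lands on the ellipse, and a smaller r
    gives strictly smaller semi-axes, hence a point of the open elliptic disc. *)
Lemma joukowsky_inside_or_on (rho r theta : R) : 1 < rho -> 1 <= r <= rho ->
  let z := ((r + / r) / 2 * cos theta, (r - / r) / 2 * sin theta) in
  inside (bernstein_ellipse rho) z \/ bernstein_ellipse rho z.
Proof.
intros Hrho [Hr1 Hr2] z.
pose proof (Rinv_between_0_1 rho Hrho) as Hi.
pose proof (sin2_cos2 theta) as Hsc; unfold Rsqr in Hsc.
set (A := (rho + / rho) / 2). set (B := (rho - / rho) / 2).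
assert (HA : 0 < A) by (unfold A; lra). assert (HB : 0 < B) by (unfold B; lra).
destruct (Req_dec r rho) as [->|Hne].
- right. apply bernstein_ellipse_equation; [exact Hrho|]. unfold z; cbn [fst snd]. fold A B.
  replace (A * cos theta / A) with (cos theta) by (field; lra).
  replace (B * sin theta / B) with (sin theta) by (field; lra). lra.
- left. apply inside_bernstein_ellipse; [exact Hrho|]. unfold z; cbn [fst snd]. fold A B.
  assert (Hri : / rho < / r <= 1).
  { split; [apply Rinv_lt_contravar; nra | rewrite <- Rinv_1; apply Rinv_le_contravar; lra]. }
  assert (Hrr : r * / r = 1) by (apply Rinv_r; lra).
  assert (Hpp : rho * / rho = 1) by (apply Rinv_r; lra).
  assert (H1 : 0 <= (r + / r) / 2 / A < 1).
  { split; [apply Rdiv_le_0_compat; lra|]. apply (Rdiv_lt_1 _ _ HA). unfold A. nra. }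
  assert (H2 : 0 <= (r - / r) / 2 / B < 1).
  { split; [apply Rdiv_le_0_compat; lra|]. apply (Rdiv_lt_1 _ _ HB). unfold B. lra. }
  replace ((r + / r) / 2 * cos theta / A) with ((r + / r) / 2 / A * cos theta) by (field; lra).
  replace ((r - / r) / 2 * sin theta / B) with ((r - / r) / 2 / B * sin theta) by (field; lra).
  set (p := (r + / r) / 2 / A) in *. set (q := (r - / r) / 2 / B) in *.
  assert (p ^ 2 < 1) by nra. assert (q ^ 2 < 1) by nra.
  (* Strictness of p^2 cos^2 + q^2 sin^2 < 1 comes from the cosine term if the cosine is nonzero,
     and otherwise from the sine term, where sin^2 = 1. *)
  destruct (Req_dec (cos theta) 0) as [Hc|Hc].
  + rewrite Hc in *. nra.
  + assert (0 < cos theta ^ 2) by nra. assert (0 <= sin theta ^ 2) by nra. nra.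
Qed.

(** * The complex exponential *)

Lemma Cexp_plus (z w : C) : Cexp (z + w) = (Cexp z * Cexp w)%C.
Proof.
unfold Cexp; destruct z as [x y], w as [u v]; simpl.
rewrite exp_plus, cos_plus, sin_plus. apply injective_projections; simpl; ring.
Qed.

Lemma Cexp_0 : Cexp 0 = 1%C.
Proof. unfold Cexp; simpl. rewrite exp_0, cos_0, sin_0. apply injective_projections; simpl; ring. Qed.

Lemma Cexp_neq_0 (z : C) : Cexp z <> 0%C.
Proof.
intros Hz. pose proof (Cexp_plus z (- z)) as H.
rewrite Cplus_opp_r, Cexp_0, Hz, Cmult_0_l in H. injection H. lra.
Qed.

Lemma Cexp_opp (z : C) : Cexp (- z) = (/ Cexp z)%C.
Proof.
rewrite <- (Cmult_1_l (/ Cexp z)), <- Cexp_0, <- (Cplus_opp_r z), Cexp_plus.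
field. apply Cexp_neq_0.
Qed.

Lemma Cexp_pow (z : C) (n : nat) : (Cexp z ^ n)%C = Cexp (INR n * z).
Proof.
induction n as [|n IH]; [simpl; rewrite Cmult_0_l; symmetry; apply Cexp_0|].
rewrite S_INR, RtoC_plus, Cmult_plus_distr_r, Cmult_1_l, Cexp_plus, <- IH. simpl. ring.
Qed.

(** Clearing the difference quotient makes the estimate valid at h = 0 too, as needed when only one
    coordinate of a complex increment vanishes. *)
Lemma derivable_pt_lim_0_bound (f : R -> R) (l eps : R) :
  derivable_pt_lim f 0 l -> 0 < eps ->
  exists delta, 0 < delta /\ forall h, Rabs h < delta -> Rabs (f h - f 0 - l * h) <= eps * Rabs h.
Proof.
intros H He. destruct (H eps He) as [d Hd].
exists d. split; [apply cond_pos|]. intros h Hh.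
destruct (Req_dec h 0) as [->|Hne].
- replace (f 0 - f 0 - l * 0) with 0 by ring. rewrite Rabs_R0. lra.
- specialize (Hd h Hne Hh). rewrite Rplus_0_l in Hd.
  replace (f h - f 0 - l * h) with (((f h - f 0) / h - l) * h) by (field; exact Hne).
  rewrite Rabs_mult. apply Rmult_le_compat_r; [apply Rabs_pos | lra].
Qed.

(** The derivative of [Cexp] at 0 is 1, obtained from the real derivatives of exp, cos and sin at
    0. *)
Lemma Cexp_near_0 (eps : R) : 0 < eps -> exists delta, 0 < delta /\
  forall h, Cmod h < delta -> Cmod (Cexp h - 1 - h) <= eps * Cmod h.
Proof.
(* The real part will cost 3 e |h| and the imaginary part 5 e |h|, whence the 8. The bound e <= 1
   gives |1 + x| <= 2, and keeping |h| < e absorbs the quadratic terms. *)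
intros Heps. set (e := Rmin 1 (eps / 8)).
assert (He : 0 < e) by (apply Rmin_pos; lra).
assert (He1 : e <= 1) by apply Rmin_l. assert (He2 : e <= eps / 8) by apply Rmin_r.
clearbody e.
destruct (derivable_pt_lim_0_bound _ _ e (derivable_pt_lim_exp 0) He) as [d1 [Hd1 H1]].
destruct (derivable_pt_lim_0_bound _ _ e (derivable_pt_lim_cos 0) He) as [d2 [Hd2 H2]].
destruct (derivable_pt_lim_0_bound _ _ e (derivable_pt_lim_sin 0) He) as [d3 [Hd3 H3]].
rewrite exp_0 in H1. rewrite cos_0, sin_0 in H2. rewrite sin_0, cos_0 in H3.
exists (Rmin e (Rmin d1 (Rmin d2 d3))).
split; [repeat apply Rmin_pos; assumption|].
intros [x y] Hh.
pose proof (re_le_Cmod (x, y)) as Hx. pose proof (Rmax_Cmod (x, y)) as Hy. simpl in Hx, Hy.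
assert (Hy' := Rle_trans _ _ _ (Rmax_r _ _) Hy). clear Hy.
pose proof (Rmin_l e (Rmin d1 (Rmin d2 d3))). pose proof (Rmin_r e (Rmin d1 (Rmin d2 d3))).
pose proof (Rmin_l d1 (Rmin d2 d3)). pose proof (Rmin_r d1 (Rmin d2 d3)).
pose proof (Rmin_l d2 d3). pose proof (Rmin_r d2 d3).
specialize (H1 x ltac:(lra)). specialize (H2 y ltac:(lra)). specialize (H3 y ltac:(lra)).
set (N := Cmod (x, y)) in *. pose proof (Cmod_ge_0 (x, y)) as HN; fold N in HN.
eapply Rle_trans; [apply Cmod_le_Rabs_plus|]. unfold Cexp; simpl.
replace (cos y - 1 - - 0 * y) with (cos y - 1) in H2 by ring.
replace (sin y - 0 - 1 * y) with (sin y - y) in H3 by ring.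
replace (exp x - 1 - 1 * x) with (exp x - 1 - x) in H1 by ring.
(* Both parts are expanded in the first-order remainders of exp x = 1 + x + p, cos y = 1 + q and sin
   y = y + s. *)
replace (exp x * cos y + - (1) + - x) with ((exp x - 1 - x) * cos y + (1 + x) * (cos y - 1)) by ring.
replace (exp x * sin y + - 0 + - y) with (((exp x - 1 - x) + x) * ((sin y - y) + y) + (sin y - y)) by ring.
set (p := exp x - 1 - x) in *. set (q := cos y - 1) in *. set (s := sin y - y) in *.
assert (Hcos : Rabs (cos y) <= 1) by (apply Rabs_le, COS_bound).
assert (Hp : Rabs p <= e * N) by nra. assert (Hq : Rabs q <= e * N) by nra.
assert (Hs : Rabs s <= e * N) by nra.
assert (B1 : Rabs (p * cos y + (1 + x) * q) <= e * N + 2 * (e * N)).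
{ eapply Rle_trans; [apply Rabs_triang|]. rewrite !Rabs_mult.
  assert (Rabs (1 + x) <= 2) by (eapply Rle_trans; [apply Rabs_triang | rewrite Rabs_R1; lra]).
  pose proof (Rabs_pos p). pose proof (Rabs_pos q). pose proof (Rabs_pos (1 + x)). nra. }
assert (B2 : Rabs ((p + x) * (s + y) + s) <= 4 * (e * N) + e * N).
{ eapply Rle_trans; [apply Rabs_triang|]. rewrite Rabs_mult.
  assert (Rabs (p + x) <= 2 * N) by (eapply Rle_trans; [apply Rabs_triang | nra]).
  assert (Rabs (s + y) <= 2 * N) by (eapply Rle_trans; [apply Rabs_triang | nra]).
  pose proof (Rabs_pos (p + x)). pose proof (Rabs_pos (s + y)).
  assert (Rabs (p + x) * Rabs (s + y) <= 2 * N * (2 * N)) by (apply Rmult_le_compat; assumption).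
  assert (N * N <= e * N) by (apply Rmult_le_compat_r; lra). lra. }
assert (8 * (e * N) <= eps * N) by nra. lra.
Qed.

(** The functional equation moves the estimate at 0 to [z], at the cost of a factor |Cexp z|. *)
Lemma is_Cderive_Cexp (z : C) : is_Cderive Cexp z (Cexp z).
Proof.
apply is_Cderive_eps. intros eps.
pose proof (Cmod_ge_0 (Cexp z)) as HC.
assert (He : 0 < eps / (1 + Cmod (Cexp z))) by (apply Rdiv_lt_0_compat; [apply cond_pos | lra]).
destruct (Cexp_near_0 _ He) as [d [Hd H]].
exists (mkposreal d Hd). intros w Hw. specialize (H _ Hw).
replace (Cexp w) with (Cexp z * Cexp (w - z))%C by (rewrite <- Cexp_plus; f_equal; ring).
replace (_ - _)%C with (Cexp z * (Cexp (w - z) - 1 - (w - z)))%C by ring.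
rewrite Cmod_mult. set (k := Cmod (Cexp z)) in *.
apply Rle_trans with (k * (eps / (1 + k) * Cmod (w - z))); [apply Rmult_le_compat_l; assumption|].
replace (k * _) with (eps * Cmod (w - z) - eps / (1 + k) * Cmod (w - z)) by (field; lra).
pose proof (Cmod_ge_0 (w - z)). nra.
Qed.

Lemma ex_Cderive_mult (f g : C -> C) (z : C) :
  ex_Cderive f z -> ex_Cderive g z -> ex_Cderive (fun w => f w * g w)%C z.
Proof.
intros [l Hl] [m Hm]. eexists. apply (is_derive_mult (K := C_AbsRing) f g z l m Hl Hm Cmult_comm).
Qed.

Lemma ex_Cderive_plus (f g : C -> C) (z : C) :
  ex_Cderive f z -> ex_Cderive g z -> ex_Cderive (fun w => f w + g w)%C z.
Proof. apply (ex_derive_plus (K := C_AbsRing) (V := AbsRing_NormedModule C_AbsRing)). Qed.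

Lemma ex_Cderive_opp (f : C -> C) (z : C) : ex_Cderive f z -> ex_Cderive (fun w => - f w)%C z.
Proof. apply (ex_derive_opp (K := C_AbsRing) (V := AbsRing_NormedModule C_AbsRing)). Qed.

Lemma ex_Cderive_const (k z : C) : ex_Cderive (fun _ => k) z.
Proof. apply (ex_derive_const (K := C_AbsRing) (V := AbsRing_NormedModule C_AbsRing)). Qed.

Lemma ex_Cderive_comp (f g : C -> C) (z : C) :
  ex_Cderive f (g z) -> ex_Cderive g z -> ex_Cderive (fun w => f (g w)) z.
Proof. apply (ex_derive_comp (K := C_AbsRing) (V := AbsRing_NormedModule C_AbsRing)). Qed.

Lemma ex_Cderive_pow (f : C -> C) (n : nat) (z : C) : ex_Cderive f z -> ex_Cderive (fun w => f w ^ n)%C z.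
Proof.
intros H. induction n as [|n IH]; simpl; [apply ex_Cderive_const | apply ex_Cderive_mult; assumption].
Qed.

Lemma ex_Cderive_Cexp (z : C) : ex_Cderive Cexp z.
Proof. exists (Cexp z). apply is_Cderive_Cexp. Qed.

Lemma ex_Cderive_Cexp_opp (z : C) : ex_Cderive (fun w => Cexp (- w)) z.
Proof.
apply (ex_Cderive_comp Cexp Copp); [apply ex_Cderive_Cexp|].
apply ex_Cderive_opp. apply (ex_derive_id (K := C_AbsRing)).
Qed.

(** * The two contours *)

(** This is g(w) of the overview at w = [Cexp z]. Negative powers of w are written as powers of
    [Cexp (- z)], so that differentiation in z needs no quotient rule. *)
Definition annulus_integrand (f : C -> C) (n : nat) (z : C) : C :=
  (f (/ 2 * (Cexp z + Cexp (- z))) * (1 - Cexp (- z) ^ 2) * Cexp (- z) ^ n)%C.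

Lemma Cexp_polar (s theta : R) : Cexp (s, theta) = (exp s * Cexp (Ci * theta))%C.
Proof.
replace (Ci * theta)%C with ((0, theta) : C) by (apply injective_projections; simpl; ring).
unfold Cexp; simpl. rewrite exp_0. apply injective_projections; simpl; ring.
Qed.

Lemma joukowsky_Cexp (s theta : R) :
  (/ 2 * (Cexp (s, theta) + Cexp (- (s, theta))))%C =
  ((exp s + / exp s) / 2 * cos theta, (exp s - / exp s) / 2 * sin theta).
Proof.
rewrite <- joukowsky_polar by apply Rgt_not_eq, exp_pos.
replace (Cexp (- (s, theta))) with (/ exp s * Cexp (- (Ci * theta)))%C; [rewrite Cexp_polar; reflexivity|].
rewrite !Cexp_opp, Cexp_polar. field. split; [apply Cexp_neq_0|].
intros H. apply RtoC_inj in H. apply (Rgt_not_eq _ _ (exp_pos s) H).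
Qed.

(** The condition on [s] says 1 <= |w| <= rho for w = [Cexp (s, theta)], so the Joukowsky image lies
    inside or on the ellipse. *)
Lemma ex_Cderive_in_annulus (f : C -> C) (rho s theta : R) :
  1 < rho -> analytic_inside_and_on f (bernstein_ellipse rho) -> 0 <= s <= ln rho ->
  ex_Cderive f (/ 2 * (Cexp (s, theta) + Cexp (- (s, theta))))%C.
Proof.
intros Hrho Hf [Hs1 Hs2]. apply ex_Cderive_of_C_NormedModule.
apply (locally_singleton (T := C_UniformSpace)), Hf.
rewrite joukowsky_Cexp. apply joukowsky_inside_or_on; [exact Hrho|]. split.
- rewrite <- exp_0. destruct Hs1 as [H| <-]; [left; apply exp_increasing, H | right; reflexivity].
- rewrite <- (exp_ln rho) by lra. destruct Hs2 as [H| ->]; [left; apply exp_increasing, H | right; reflexivity].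
Qed.

Lemma ex_Cderive_annulus_integrand (f : C -> C) (n : nat) (z : C) :
  ex_Cderive f (/ 2 * (Cexp z + Cexp (- z)))%C -> ex_Cderive (annulus_integrand f n) z.
Proof.
intros Hf. unfold annulus_integrand.
apply ex_Cderive_mult; [apply ex_Cderive_mult|].
- apply (ex_Cderive_comp f (fun z => / 2 * (Cexp z + Cexp (- z)))%C); [exact Hf|].
  apply ex_Cderive_mult; [apply ex_Cderive_const|].
  apply ex_Cderive_plus; [apply ex_Cderive_Cexp | apply ex_Cderive_Cexp_opp].
- apply ex_Cderive_plus; [apply ex_Cderive_const|].
  apply ex_Cderive_opp, ex_Cderive_pow, ex_Cderive_Cexp_opp.
- apply ex_Cderive_pow, ex_Cderive_Cexp_opp.
Qed.

Lemma annulus_integrand_2PI (f : C -> C) (n : nat) (s : R) :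
  annulus_integrand f n (s, 2 * PI) = annulus_integrand f n (s, 0).
Proof.
assert (H : Cexp (s, 2 * PI) = Cexp (s, 0))
  by (unfold Cexp; simpl; rewrite cos_2PI, sin_2PI, cos_0, sin_0; reflexivity).
unfold annulus_integrand. rewrite !Cexp_opp, H. reflexivity.
Qed.

Lemma CInt_annulus_invariant (f : C -> C) (rho : R) (n : nat) :
  1 < rho -> analytic_inside_and_on f (bernstein_ellipse rho) ->
  CInt (fun theta => annulus_integrand f n (ln rho, theta)) 0 (2 * PI) =
  CInt (fun theta => annulus_integrand f n (0, theta)) 0 (2 * PI).
Proof.
intros Hrho Hf. pose proof PI_RGT_0.
assert (Hl : 0 < ln rho) by (rewrite <- ln_1; apply ln_increasing; lra).
(* The factor [- Ci] cancels the [Ci] of the vertical sides, leaving plain integrals in theta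
   there. *)
pose proof (Goursat_rectangle (fun z => - Ci * annulus_integrand f n z)%C 0 (ln rho) 0 (2 * PI)) as HG.
unfold rect_int in HG.
assert (HC : forall z : C, (Ci * (- Ci * z))%C = z).
{ intros [x y]; apply injective_projections; simpl; ring. }
rewrite (CInt_ext (fun x => _ * annulus_integrand f n (x, (2 * PI)%R))%C
  (fun x => - Ci * annulus_integrand f n (x, 0%R))%C) in HG
  by (intros; rewrite annulus_integrand_2PI; reflexivity).
rewrite (CInt_ext (fun y => _ * (_ * annulus_integrand f n (ln rho, y)))%C
  (fun y => annulus_integrand f n (ln rho, y))) in HG by (intros; apply HC).
rewrite (CInt_ext (fun y => _ * (_ * annulus_integrand f n (0%R, y)))%C
  (fun y => annulus_integrand f n (0, y))) in HG by (intros; apply HC).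
(* Here [h] is the integral over either horizontal side; the two coincide by periodicity and drop
   out. *)
assert (HZ : forall h u v : C, (h + u - h - v = 0 -> u = v)%C).
{ intros h u v E. replace u with (v + (h + u - h - v))%C by ring. rewrite E. ring. }
apply HZ with (1 := HG ltac:(lra) ltac:(lra) ltac:(intros x y Hx Hy;
  apply ex_Cderive_mult; [apply ex_Cderive_const |
  apply ex_Cderive_annulus_integrand, ex_Cderive_in_annulus with rho; assumption])).
Qed.

(** On |w| = rho one has w^-n = rho^-n e^{-in theta}; extracting rho^-n produces the prefactor of
    the coefficient formula. *)
Lemma annulus_integrand_circle (f : C -> C) (rho theta : R) (n : nat) :
  0 < rho ->
  ((rho ^ n)%R * annulus_integrand f n (ln rho, theta))%C =
  (let w := (rho * Cexp (Ci * theta))%C in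
   f (/ 2 * (w + / w)) * (1 - / w ^ 2) * Cexp (- (Ci * INR n * theta)))%C.
Proof.
intros Hrho. unfold annulus_integrand. cbv zeta.
rewrite !Cexp_opp, Cexp_polar, exp_ln by exact Hrho.
replace (Cexp (Ci * INR n * theta)) with (Cexp (Ci * theta) ^ n)%C by (rewrite Cexp_pow; f_equal; ring).
set (e := Cexp (Ci * theta)).
assert (He : e <> 0%C) by apply Cexp_neq_0.
assert (Hr : RtoC rho <> 0%C) by (intros H; apply RtoC_inj in H; lra).
assert (Hw : (rho * e)%C <> 0%C) by (apply Cmult_neq_0; assumption).
rewrite RtoC_pow, !Cpow_inv by exact Hw. rewrite !(Cpow_mult_l _ _ n).
field. repeat split; try apply Cpow_nz; assumption.
Qed.

(** * Real substitutions and reduction to the interval [-1, 1] *)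

Lemma is_CInt_decreasing_comp (h : R -> C) (phi dphi : R -> R) (a b : R) :
  (forall x, Rmin a b <= x <= Rmax a b -> RCcontinuous h (phi x)) ->
  (forall x, Rmin a b <= x <= Rmax a b -> is_derive phi x (- dphi x) /\ continuous dphi x) ->
  ex_CInt h (phi a) (phi b) ->
  is_RInt (V := C_R_NormedModule) (fun x => dphi x * h (phi x))%C a b (CInt h (phi b) (phi a)).
Proof.
intros Hh Hphi Hex.
pose proof (is_RInt_comp (V := C_R_CompleteNormedModule) h phi (fun x => - dphi x) a b Hh) as H.
(* The minus sign of the derivative is absorbed by exchanging the limits of integration. *)
replace (CInt h (phi b) (phi a)) with (opp (G := C_R_NormedModule) (CInt h (phi a) (phi b)))
  by exact (opp_RInt_swap (V := C_R_CompleteNormedModule) h (phi a) (phi b) Hex).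
apply (is_RInt_ext (V := C_R_NormedModule)
  (fun y => opp (scal (V := C_R_NormedModule) (- dphi y) (h (phi y))))).
- intros x _. rewrite scal_RtoC, RtoC_opp. change (- (- dphi x * h (phi x)) = dphi x * h (phi x))%C. ring.
- apply (is_RInt_opp (V := C_R_NormedModule)), H.
  intros x Hx. destruct (Hphi x Hx) as [H1 H2]. split; [exact H1|].
  apply (continuous_opp (V := R_NormedModule)), H2.
Qed.

(** The half [L, 2 L] is reflected onto [0, L]. With L = pi this pairs theta with 2 pi - theta, two
    angles with the same cosine. *)
Lemma CInt_fold (g : R -> C) (L : R) :
  0 <= L -> (forall x, 0 <= x <= 2 * L -> RCcontinuous g x) ->
  CInt g 0 (2 * L) = CInt (fun x => g x + g (2 * L - x)%R)%C 0 L.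
Proof.
intros HL Hg.
assert (Hex : forall a b, 0 <= a <= 2 * L -> 0 <= b <= 2 * L -> ex_CInt g a b).
{ intros a b Ha Hb. apply ex_CInt_continuous. intros x Hx. apply Hg.
  unfold Rmin, Rmax in Hx. destruct (Rle_dec a b); lra. }
assert (H : is_RInt (V := C_R_NormedModule) (fun x => 1%R * g (2 * L - x)%R)%C 0 L (CInt g (2 * L - L) (2 * L - 0))).
{ apply (is_CInt_decreasing_comp g (fun x => 2 * L - x) (fun _ => 1)).
  - rewrite Rmin_left, Rmax_right by lra. intros x Hx. apply Hg. lra.
  - intros x _. split; [auto_derive; [exact I | ring] | apply continuous_const].
  - apply Hex; lra. }
replace (2 * L - L) with L in H by ring. rewrite Rminus_0_r in H.
apply (is_RInt_ext (V := C_R_NormedModule)) with (g := fun x => g (2 * L - x)) in H; [|intros; apply Cmult_1_l].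
rewrite <- (CInt_Chasles g 0 L (2 * L)) by (apply Hex; lra).
rewrite CInt_plus; [f_equal | apply Hex; lra | eexists; exact H].
symmetry. exact (is_RInt_unique (V := C_R_CompleteNormedModule) _ _ _ _ H).
Qed.

Lemma is_CInt_cos (h : R -> C) :
  (forall x, -1 <= x <= 1 -> RCcontinuous h x) ->
  is_RInt (V := C_R_NormedModule) (fun theta => sin theta * h (cos theta))%C 0 PI (CInt h (-1) 1).
Proof.
intros Hh.
rewrite <- cos_PI, <- cos_0.
apply (is_CInt_decreasing_comp h cos sin).
- intros x _. apply Hh, COS_bound.
- intros x _. split; [apply is_derive_Reals, derivable_pt_lim_cos|].
  apply (ex_derive_continuous (K := R_AbsRing) (V := R_NormedModule)); auto_derive; exact I.
- apply ex_CInt_continuous. rewrite cos_0, cos_PI, Rmin_right, Rmax_left by lra. exact Hh.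
Qed.

Lemma continuous_chebU (n : nat) (x : R) : continuous (chebU n) x.
Proof.
(* The recurrence reaches two degrees back, so the induction carries a consecutive pair. *)
cut (continuous (chebU n) x /\ continuous (chebU (S n)) x); [tauto|].
induction n as [|n [IH1 IH2]].
- split; [apply continuous_const|].
  apply (continuous_scal_r (V := R_NormedModule) 2), continuous_id.
- split; [exact IH2|].
  apply (continuous_ext (fun x => minus (mult (mult 2 x) (chebU (S n) x)) (chebU n x)));
    [reflexivity|].
  apply (continuous_minus (V := R_NormedModule)); [|exact IH1].
  apply (continuous_mult (K := R_AbsRing)); [|exact IH2].
  apply (continuous_scal_r (V := R_NormedModule) 2), continuous_id.
Qed.

(* With [t = theta], this is
   [e^{-int} (1 - e^{-2it}) + e^{int} (1 - e^{2it}) = 2 cos (nt) - 2 cos ((n+2)t)]. *)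
Lemma annulus_integrand_unit_circle (f : C -> C) (n : nat) (theta : R) :
  (annulus_integrand f n (0%R, theta) + annulus_integrand f n (0%R, 2 * PI - theta)%R)%C =
  (4%R * (sin theta * ((sin theta * chebU n (cos theta))%R * f (RtoC (cos theta)))))%C.
Proof.
assert (Hf : forall t, cos t = cos theta -> (/ 2 * (Cexp (0%R, t) + Cexp (- (0%R, t))))%C = RtoC (cos theta)).
{ intros t Ht. rewrite joukowsky_Cexp, exp_0, Rinv_1, Ht. apply injective_projections; simpl; field. }
unfold annulus_integrand.
assert (Hc : cos (2 * PI - theta) = cos theta) by (rewrite cos_minus, cos_2PI, sin_2PI; ring).
rewrite !Hf by first [reflexivity | exact Hc].
assert (He : Cexp (- (0%R, 2 * PI - theta)%R) = Cexp (0%R, theta)).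
{ unfold Cexp; simpl. rewrite Ropp_0, Ropp_minus_distr, cos_minus, sin_minus, cos_2PI, sin_2PI.
  apply injective_projections; simpl; ring. }
rewrite He, !Cexp_pow.
rewrite (Rmult_comm (sin theta)), (proj1 (chebU_sin n theta)).
transitivity (f (RtoC (cos theta)) *
  (Cexp (INR n * - (0%R, theta)) - Cexp (INR 2 * - (0%R, theta)) * Cexp (INR n * - (0%R, theta))
   + (Cexp (INR n * (0%R, theta)) - Cexp (INR 2 * (0%R, theta)) * Cexp (INR n * (0%R, theta)))))%C; [ring|].
assert (Hk : forall k t : R, Cexp (k * (0%R, t)) = (cos (k * t), sin (k * t))).
{ intros k t. unfold Cexp; simpl. replace (k * 0 - 0 * t) with 0 by ring.
  replace (k * t + 0 * 0) with (k * t) by ring. rewrite exp_0, !Rmult_1_l. reflexivity. }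
assert (Hkn : forall z : C, (Cexp (INR 2 * z) * Cexp (INR n * z))%C = Cexp ((INR n + 2)%R * z)).
{ intros z. rewrite <- Cexp_plus, RtoC_plus. f_equal. simpl INR. rewrite RtoC_plus. ring. }
rewrite !Hkn.
replace (- (0%R, theta))%C with ((0%R, - theta) : C) by (apply injective_projections; simpl; ring).
rewrite !Hk.
transitivity (f (RtoC (cos theta)) * (4 * (sin theta * sin ((INR n + 1) * theta)))%R)%C;
  [f_equal | rewrite !RtoC_mult; ring].
(* With this m, the angles n theta and (n + 2) theta are m - theta and m + theta, and cos (m -
   theta) - cos (m + theta) = 2 sin m sin theta. *)
set (m := (INR n + 1) * theta).
replace (INR n * - theta) with (- (m - theta)) by (unfold m; ring).
replace ((INR n + 2) * - theta) with (- (m + theta)) by (unfold m; ring).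
replace (INR n * theta) with (m - theta) by (unfold m; ring).
replace ((INR n + 2) * theta) with (m + theta) by (unfold m; ring).
rewrite !cos_neg, !sin_neg, !cos_minus, !cos_plus.
apply injective_projections; simpl; ring.
Qed.

Theorem lemma2p2 (rho : R) (f : C -> C) (hrho : 1 < rho)
    (hf : analytic_inside_and_on f (bernstein_ellipse rho)) (n : nat) :
  cheb_coef2 f n =
  ((/ (2 * PI * rho ^ n))%R *
   CInt (fun theta : R =>
      let w := (rho * Cexp (Ci * theta))%C in
      f (/ 2 * (w + / w)) * (1 - / w ^ 2) * Cexp (- (Ci * INR n * theta)))
     0 (2 * PI))%C.
Proof.
pose proof PI_RGT_0 as Hpi.
assert (Hl : 0 < ln rho) by (rewrite <- ln_1; apply ln_increasing; lra).
assert (Hcont : forall s, 0 <= s <= ln rho -> forall theta,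
  RCcontinuous (fun theta => annulus_integrand f n (s, theta)) theta).
{ intros s Hs theta.
  apply (continuous_comp (V := C_UniformSpace) (fun y : R => (s, y)) (annulus_integrand f n)).
  - apply RCcontinuous_pair; [apply continuous_const | apply continuous_id].
  - destruct (ex_Cderive_annulus_integrand f n (s, theta)) as [l Hd];
      [apply ex_Cderive_in_annulus with rho; assumption|].
    exact (is_Cderive_continuous _ _ _ Hd). }
assert (Hfc : forall x, -1 <= x <= 1 -> RCcontinuous (fun x => f (RtoC x)) x).
{ intros x Hx. apply (continuous_comp (V := C_UniformSpace) RtoC f).
  - apply RCcontinuous_pair; [apply continuous_id | apply continuous_const].
  (* A point x of [-1, 1] is the Joukowsky image of e^{i acos x}, on the unit circle s = 0. *)
  - destruct (ex_Cderive_in_annulus f rho 0 (acos x) hrho hf ltac:(lra)) as [l Hd].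
    apply is_Cderive_continuous in Hd. rewrite joukowsky_Cexp, exp_0, Rinv_1, cos_acos in Hd by exact Hx.
    replace (_, _) with (RtoC x) in Hd by (apply injective_projections; simpl; field). exact Hd. }
rewrite (CInt_ext _ (fun theta => (rho ^ n)%R * annulus_integrand f n (ln rho, theta))%C)
  by (intros; symmetry; apply annulus_integrand_circle; lra).
rewrite CInt_scal by (apply ex_CInt_continuous; intros; apply Hcont; lra).
rewrite CInt_annulus_invariant by assumption.
rewrite CInt_fold by (try lra; intros; apply Hcont; lra).
rewrite (CInt_ext _ _ _ _ (fun x _ => annulus_integrand_unit_circle f n x)).
unfold cheb_coef2.
rewrite (CInt_ext _ (fun x => (sqrt (1 - x ^ 2) * chebU n x)%R * f (RtoC x))%C)
  by (intros; rewrite RtoC_mult; ring).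
assert (Hh : forall x, -1 <= x <= 1 ->
  RCcontinuous (fun x => (sqrt (1 - x ^ 2) * chebU n x)%R * f (RtoC x))%C x).
{ intros x Hx.
  apply (continuous_ext (fun x => scal (V := C_R_NormedModule) (sqrt (1 - x ^ 2) * chebU n x) (f (RtoC x)))).
  { intros t. apply scal_RtoC. }
  apply (continuous_scal (V := C_R_NormedModule)); [|apply Hfc, Hx].
  apply (continuous_mult (K := R_AbsRing)); [|apply continuous_chebU].
  apply (continuous_comp (fun x => 1 - x ^ 2) sqrt); [|apply continuous_sqrt].
  apply (ex_derive_continuous (K := R_AbsRing) (V := R_NormedModule)); auto_derive; exact I. }
apply is_CInt_cos in Hh.
apply (is_RInt_ext (V := C_R_NormedModule)) with
  (g := fun theta : R => (sin theta * ((sin theta * chebU n (cos theta))%R * f (RtoC (cos theta))))%C) in Hh.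
(* On [0, pi] the sine is nonnegative, so sqrt (1 - cos^2) is the sine itself; the other sine factor
   comes from dx. *)
2: { rewrite Rmin_left, Rmax_right by lra. intros x Hx.
  replace (1 - cos x ^ 2) with (Rsqr (sin x)) by (rewrite sin2; unfold Rsqr; ring).
  rewrite sqrt_Rsqr by (apply sin_ge_0; lra). reflexivity. }
rewrite CInt_scal by (eexists; exact Hh).
replace (CInt _ 0 PI) with (CInt (fun x => (sqrt (1 - x ^ 2) * chebU n x)%R * f (RtoC x))%C (-1) 1)
  by (symmetry; exact (is_RInt_unique (V := C_R_CompleteNormedModule) _ _ _ _ Hh)).
(* Both sides now carry the same integral, and the constants agree: 4 rho^n / (2 pi rho^n) = 2 /
   pi. *)
rewrite !Cmult_assoc, <- !RtoC_mult. do 2 f_equal.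
field. split; [apply pow_nonzero|]; lra.
Qed.
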